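(* Let $X_1,X_2,\dots$ be independent observations on a random variable $X$ with absolutely continuous c.d.f. $F$. For any fixed $s\in\{2,3,\dots\}$, as $k\to\infty$, $$L_{(s+1)k-1}\left(F,\tfrac1{s+1}\right)\stackrel{P}{\to}L\left(F,\tfrac1{s+1}\right),\qquad R_{(s+1)k-1}\left(F,\tfrac1{s+1}\right)\stackrel{P}{\to}R\left(F,\tfrac1{s+1}\right),$$ where $\stackrel{P}{\to}$ denotes convergence in probability.
   Context: For an absolutely continuous c.d.f. $F$ and $q\in(0,1)$, the quantile function is $F^{\leftarrow}(q)=\inf\{x\in\mathbb R:F(x)\ge q\}=\sup\{x\in\mathbb R:F(x)\le q\}$ (the equality of the two expressions is part of the convention). For $p\in(0,0.5]$ the theoretical fences are $$R(F,p)=\tfrac1pF^{\leftarrow}(1-p)-\tfrac{1-p}{p}F^{\leftarrow}(p),\qquad L(F,p)=\tfrac1pF^{\leftarrow}(p)-\tfrac{1-p}{p}F^{\leftarrow}(1-p).$$ For a sample $X_1,\dots,X_n$ with order statistics $X_{(1,n)}\le\dots\le X_{(n,n)}$, the empirical $q$-quantile is $F_n^{\leftarrow}(q)=X_{([(n+1)q],n)}$ for $q\in[\frac1{n+1},\frac n{n+1}]$, where $[a]$ is the integer part of $a$. The empirical fences are $$R_n(F,p)=\tfrac1pF_n^{\leftarrow}(1-p)-\tfrac{1-p}{p}F_n^{\leftarrow}(p),\qquad L_n(F,p)=\tfrac1pF_n^{\leftarrow}(p)-\tfrac{1-p}{p}F_n^{\leftarrow}(1-p).$$ Thus for $n=(s+1)k-1$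 and $p=\frac1{s+1}$: $L_n=(s+1)X_{(k,n)}-sX_{(sk,n)}$ and $R_n=(s+1)X_{(sk,n)}-sX_{(k,n)}$. *)

(* Defs.v *)
From HB Require Import structures.
From mathcomp Require Import all_boot all_order all_algebra finmap.
From mathcomp Require Import all_classical all_reals all_analysis.

Set Implicit Arguments.
Unset Strict Implicit.
Unset Printing Implicit Defensive.

Import Order.TTheory GRing.Theory Num.Theory.
Import numFieldNormedType.Exports.

Local Open Scope classical_set_scope.
Local Open Scope ring_scope.

Section fences.
Context {R : realType}.
Implicit Types (F : R -> R) (p q : R) (x : nat -> R) (n j : nat).

Definition absolutely_continuous F : Prop :=
  forall e : R, 0 < e -> exists2 d : R, 0 < d &
    forall (m : nat) (a b : 'I_m -> R),
      (forall i, a i <= b i) ->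
      trivIset [set: 'I_m] (fun i => `]a i, b i[%classic) ->
      \sum_(i < m) (b i - a i) < d ->
      \sum_(i < m) `|F (b i) - F (a i)| < e.

Definition quantile F q : R := inf [set x | q <= F x].

Definition unique_quantiles F : Prop :=
  forall q, 0 < q < 1 -> quantile F q = sup [set x | F x <= q].

Definition right_fence F p : R :=
  p^-1 * quantile F (1 - p) - (1 - p) / p * quantile F p.

Definition left_fence F p : R :=
  p^-1 * quantile F p - (1 - p) / p * quantile F (1 - p).

(* The sample of size n is x 0, ..., x n.-1, while the rank j counts from 1:
   this is the order statistic X_(j,n), meaningful for 1 <= j <= n. *)
Definition order_stat x n j : R :=
  nth 0 (sort <=%R [seq x i | i <- iota 0 n]) j.-1.

(* Meaningful for 1/(n+1) <= q <= n/(n+1). *)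
Definition emp_quantile x n q : R := order_stat x n (Num.truncn (n.+1%:R * q)).

Definition emp_right_fence x n p : R :=
  p^-1 * emp_quantile x n (1 - p) - (1 - p) / p * emp_quantile x n p.

Definition emp_left_fence x n p : R :=
  p^-1 * emp_quantile x n p - (1 - p) / p * emp_quantile x n (1 - p).

End fences.

Section random_sequences.
Context {d : measure_display} {T : measurableType d} {R : realType}.
Variable P : probability T R.

(* Mutual independence: the product rule over every finite subfamily. *)
Definition independent_RVs (X : nat -> {RV P >-> R}) : Prop :=
  forall (J : {fset nat}) (B : nat -> set R),
    (forall i, i \in J -> measurable (B i)) ->
    P (\bigcap_(i in [set` J]) (X i @^-1` B i)) =
      (\prod_(i <- J) P (X i @^-1` B i))%E.

Definition cvg_in_probability (Y : nat -> T -> R) (c : R) : Prop :=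
  forall e : R, 0 < e ->
    P [set w | e < `|Y k w - c|] @[k --> \oo] --> (0 : \bar R)%E.

End random_sequences.

(* Main.v *)
(* The order statistic X_(j,n) is at most a iff at least j of the n observations
   are at most a. By Chebyshev's inequality the number of observations at most a
   is close to n F(a), and unicity of the quantile Q at level q gives
   F(Q - e) < q < F(Q + e); so the empirical quantiles converge in probability
   to Q along all sample sizes. The fences are fixed linear combinations of
   two empirical quantiles, taken along the sample sizes (s+1)k - 1. *)
Require Import Defs.
From HB Require Import structures.
From mathcomp Require Import all_boot all_order all_algebra finmap.
From mathcomp Require Import all_classical all_reals all_analysis.
From mathcomp Require Import measurable_realfun ring lra.

Set Implicit Arguments.
Unset Strict Implicit.
Unset Printing Implicit Defensive.

Import Order.TTheory GRing.Theory Num.Theory.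
Import numFieldNormedType.Exports.

Local Open Scope classical_set_scope.
Local Open Scope ring_scope.

(** Sorting preserves counts, and in a sorted list the entries at most [a] form a prefix. The bounds
    on [j] exclude rank 0, where [j.-1] truncates, and ranks above [n], where [nth] returns its
    default. *)
Lemma order_stat_leE (R : realType) (x : nat -> R) (n j : nat) (a : R) :
  (0 < j <= n)%N ->
  (order_stat x n j <= a) = (j <= count (fun i => (x i <= a)%R) (iota 0 n))%N.
Proof.
case: j => // j /= jn; rewrite /order_stat /=.
set t := sort _ _.
have st : sorted <=%R t by apply: sort_sorted; exact: le_total.
have ct : count (fun i => x i <= a) (iota 0 n) = count (<= a) t.
  by rewrite (permP (permEl (perm_sort _ _))) count_map.
rewrite ct; apply/idP/idP => [|jt]; last exact: nth_count_le.
rewrite ltnNge; apply: contraTN => tj.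
rewrite -ltNge nth_count_gt// tj/=.
by rewrite size_sort size_map size_iota.
Qed.

Lemma count_indic (R : realType) (T : Type) (A : nat -> set T) n (w : T)
    (a : pred nat) : (forall i, a i <-> A i w) ->
  (count a (iota 0 n))%:R = \sum_(0 <= i < n) \1_(A i) w :> R.
Proof.
move=> aA; rewrite -sum1_count natr_sum /index_iota subn0 big_mkcond.
apply: eq_bigr => i _; rewrite indicE.
have [/aA Ai|/negP nai] := boolP (a i); first by rewrite mem_set.
by rewrite memNset// => /aA.
Qed.

(** * Weak law of large numbers for pairwise independent events of equal probability *)

Section weak_law.
Context {d : measure_display} {T : measurableType d} {R : realType}.
Variable P : probability T R.

Lemma Lfun_indic (p : R) (A : set T) : 1 <= p -> measurable A ->
  \1_A \in Lfun P p%:E.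
Proof.
move=> p1 mA; rewrite inE; apply/andP; split.
  by rewrite inE/=; exact: measurable_indic.
rewrite inE/= /finite_norm unlock /=.
rewrite poweR_lty//.
(* A positive power of an indicator is the indicator itself, so the integral is [P A]. *)
rewrite (eq_integral (fun x => (\1_A x)%:E)); last first.
  move=> w _ /=; rewrite indicE; case: (_ \in _).
    by rewrite normr1 powR1.
  by rewrite normr0 powR0// gt_eqF// (lt_le_trans ltr01).
by rewrite integral_indic// setIT -ge0_fin_numE// fin_num_measure.
Qed.

Variables (A : nat -> set T) (c : R).
Hypothesis mA : forall i, measurable (A i).
Hypothesis PA : forall i, P (A i) = c%:E.
Hypothesis PAA : forall i j, i != j -> P (A i `&` A j) = (c * c)%:E.

Definition occurrences n (w : T) : R := \sum_(0 <= i < n) \1_(A i) w.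

Lemma measurable_occurrences n : measurable_fun setT (occurrences n).
Proof. by apply: measurable_sum => i; exact: measurable_indic. Qed.

Lemma occurrencesS n : occurrences n.+1 = occurrences n \+ \1_(A n).
Proof. by apply/funext => w; rewrite /occurrences big_nat_recr. Qed.

Lemma occurrences0 : occurrences 0 = cst 0.
Proof. by apply/funext => w; rewrite /occurrences big_geq. Qed.

Lemma Lfun2_occurrences n : occurrences n \in Lfun P 2%:E.
Proof.
elim: n => [|n IH]; first by rewrite occurrences0 Lfun_cst.
by rewrite occurrencesS rpredD ?lee1n// => ?; apply: Lfun_indic;
  rewrite ?ler1n.
Qed.

Let Lfun2A i : \1_(A i) \in Lfun P 2%:E.
Proof. by apply: Lfun_indic => //; rewrite ler1n. Qed.

Let L21 (f : T -> R) : f \in Lfun P 2%:E -> f \in Lfun P 1.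
Proof. by apply: Lfun_subset12; exact: fin_num_measure. Qed.

Lemma expectation_occurrences n : ('E_P[occurrences n] = (n%:R * c)%:E)%E.
Proof.
elim: n => [|n IH]; first by rewrite occurrences0 expectation_cst mul0r.
rewrite occurrencesS expectationD ?L21 ?Lfun2_occurrences//.
by rewrite IH expectation_indic// PA -EFinD -natr1 mulrDl mul1r.
Qed.

(** The product of two indicators is the indicator of the intersection; the diagonal gives the
    Bernoulli variance. *)
Lemma covariance_indic i j :
  covariance P \1_(A i) \1_(A j) = (if i == j then c - c * c else 0)%:E.
Proof.
rewrite covarianceE; [|exact: L21|exact: L21|exact: Lfun2_mul_Lfun1].
rewrite -[(_ * _)%R]indicI !expectation_indic ?PA//; last exact: measurableI.
have [->|ij] := eqVneq i j; first by rewrite setIid PA -EFinM -EFinB.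
by rewrite PAA// -EFinM subee.
Qed.

Lemma covariance_occurrences n j : (n <= j)%N ->
  covariance P (occurrences n) \1_(A j) = 0%E.
Proof.
elim: n => [|n IH] nj; first by rewrite occurrences0 covariance_cst_l.
rewrite occurrencesS covarianceDl ?Lfun2_occurrences//.
by rewrite IH 1?ltnW// covariance_indic ltn_eqF// adde0.
Qed.

Lemma variance_occurrences n :
  'V_P[occurrences n] = (n%:R * (c - c * c))%:E.
Proof.
elim: n => [|n IH]; first by rewrite occurrences0 variance_cst mul0r.
rewrite occurrencesS varianceD ?Lfun2_occurrences//.
rewrite covariance_occurrences// mule0 adde0 IH.
rewrite [X in (_ + X)%E]covariance_indic eqxx -EFinD.
by rewrite -natr1 mulrDl mul1r.
Qed.

(** Chebyshev's inequality bounds the probability by [n (c - c^2) / (n e)^2], which is of order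
    [1 / n]. *)
Lemma occurrences_weak_law (e : R) : 0 < e ->
  P [set w | n%:R * e <= `|occurrences n w - n%:R * c|] @[n --> \oo]
    --> (0 : \bar R)%E.
Proof.
move=> e0.
have lim0 : ((c - c * c) / e ^+ 2 * n.+1%:R^-1)%:E @[n --> \oo]
    --> (0 : \bar R)%E.
  apply/cvg_EFin; first exact: nearW.
  rewrite -[X in _ --> X](mulr0 ((c - c * c) / e ^+ 2)).
  by apply: cvgMr; exact: cvg_harmonic.
(* The size 0 is dropped: Chebyshev's inequality needs a positive threshold. *)
rewrite -cvg_shiftS.
apply: squeeze_cvge lim0; [|exact: cvg_cst].
apply: nearW => n; rewrite measure_ge0/=.
pose N : {mfun T >-> R} := mfun_Sub (mem_set (measurable_occurrences n.+1)).
have := @chebyshev _ _ _ P N (n.+1%:R * e).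
rewrite mulr_gt0// => /(_ isT).
rewrite /N /= expectation_occurrences variance_occurrences /= -EFinM.
move=> /le_trans; apply; rewrite lee_fin.
rewrite le_eqVlt; apply/orP; left; apply/eqP.
have : n.+1%:R != 0 :> R by rewrite pnatr_eq0.
by move: n.+1%:R => m m0; field; rewrite m0 gt_eqF.
Qed.

End weak_law.

(** * Strict inequalities on both sides of a quantile *)

Section quantile.
Context {d : measure_display} {T : measurableType d} {R : realType}.
Variables (P : probability T R) (X : {RV P >-> R}) (F : R -> R).
Hypothesis XF : forall x, cdf X x = (F x)%:E.

Let cdfE : cdf X = EFin \o F. Proof. exact/funext. Qed.

Lemma cdf_real_le x y : x <= y -> F x <= F y.
Proof. by move=> xy; rewrite -lee_fin -!XF cdf_nondecreasing. Qed.

Lemma cdf_gt_exists q : q < 1 -> exists x, q < F x.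
Proof.
move=> q1; have := cvg_cdfy1 X; rewrite cdfE.
move=> /fine_cvgP[_ /=] /cvgr_gt /(_ _ q1)[M [_ MF]].
by exists (M + 1); apply: MF; rewrite ltrDl.
Qed.

Lemma cdf_lt_exists q : 0 < q -> exists x, F x < q.
Proof.
move=> q0; have := cvg_cdfNy0 X; rewrite cdfE.
move=> /fine_cvgP[_ /=] /cvgr_lt /(_ _ q0)[M [_ MF]].
by exists (M - 1); apply: MF; rewrite gtrDl oppr_lt0.
Qed.

(** If [q <= F a], then [a] lies in the set whose infimum is the quantile. *)
Lemma lt_quantile q a : 0 < q -> a < quantile F q -> F a < q.
Proof.
move=> q0; apply: contraTT; rewrite -!leNgt => qa; apply: ge_inf => //.
(* [inf] bounds a set from below only if the set has a lower bound; positivity of [q] provides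
   one. *)
have [m mq] := cdf_lt_exists q0; exists m => x /= qx.
rewrite leNgt; apply/negP => /ltW/cdf_real_le /le_lt_trans /(_ mq).
by rewrite ltNge qx.
Qed.

(** The supremum form excludes a flat piece of [F] at level [q] to the right of the quantile; this
    makes the inequality strict. *)
Lemma gt_quantile q b : q < 1 -> quantile F q = sup [set x | F x <= q] ->
  quantile F q < b -> q < F b.
Proof.
move=> q1 ->; apply: contraTT; rewrite -!leNgt => qb; apply: ub_le_sup => //.
have [m mq] := cdf_gt_exists q1; exists m => x /= qx.
rewrite leNgt; apply/negP => /ltW/cdf_real_le /(lt_le_trans mq).
by rewrite ltNge qx.
Qed.

End quantile.

(** * Rules for convergence in probability to a constant *)

Section in_probability.
Context {d : measure_display} {T : measurableType d} {R : realType}.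
Variable P : probability T R.
Implicit Types (Y Z : nat -> T -> R).

Lemma measurable_deviation (f : T -> R) (c e : R) : measurable_fun setT f ->
  measurable [set w | e < `|f w - c|].
Proof.
move=> mf; rewrite -[X in measurable X]setTI.
have mg : measurable_fun setT (fun w => `|f w - c|).
  by apply: measurableT_comp => //; exact: measurable_funB.
rewrite (_ : [set w | _] = (fun w => `|f w - c|) @^-1` `]e, +oo[).
  exact: mg.
by apply/seteqP; split => w /=; rewrite in_itv/= andbT.
Qed.

(** Union bound and squeezing. The inclusion is asked only for large [n], since the rank of an
    empirical quantile is in range only then. *)
Lemma cvg_measure0_subU (A B C : nat -> set T) :
  (forall n, measurable (A n)) -> (forall n, measurable (B n)) ->
  (forall n, measurable (C n)) ->
  (\forall n \near \oo, A n `<=` B n `|` C n) ->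
  P (B n) @[n --> \oo] --> 0%E -> P (C n) @[n --> \oo] --> 0%E ->
  P (A n) @[n --> \oo] --> 0%E.
Proof.
move=> mA mB mC ABC B0 C0.
have BC0 : (P (B n) + P (C n))%E @[n --> \oo] --> 0%E.
  by rewrite -[X in _ --> X](adde0 0%E); exact: cvgeD.
apply: squeeze_cvge BC0; [|exact: cvg_cst].
near=> n; rewrite measure_ge0/= (le_trans _ (measureU2 _ _ _))//.
by rewrite le_measure ?inE//; [exact: measurableU|near: n].
Unshelve. all: by end_near. Qed.

Lemma cvg_in_probabilityZ Y (a y : R) :
  cvg_in_probability P Y y ->
  cvg_in_probability P (fun n w => a * Y n w) (a * y).
Proof.
(* The nonzero case divides the threshold [e] by the absolute value of [a]. *)
move=> Yy e e0; have [->|a0] := eqVneq a 0.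
  rewrite [X in X @ _](_ : _ = cst 0%E); first exact: cvg_cst.
  apply/funext => n; rewrite (_ : [set _ | _] = set0) ?measure0//.
  by rewrite -subset0 => w /=; rewrite !mul0r subrr normr0 ltNge ltW.
have a_gt0 : 0 < `|a| by rewrite normr_gt0.
rewrite [X in X @ _](_ : _ = fun n => P [set w | e / `|a| < `|Y n w - y|]).
  by apply: Yy; rewrite divr_gt0.
apply/funext => n; congr (P _); apply/seteqP.
by split => w /=; rewrite -mulrBr normrM ltr_pdivrMr// mulrC.
Qed.

(** By the triangle inequality, a deviation above [e] forces one of the two terms to deviate by more
    than [e / 2]. *)
Lemma cvg_in_probabilityB Y Z (y z : R) :
  (forall n, measurable_fun setT (Y n)) ->
  (forall n, measurable_fun setT (Z n)) ->
  cvg_in_probability P Y y -> cvg_in_probability P Z z ->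
  cvg_in_probability P (fun n w => Y n w - Z n w) (y - z).
Proof.
move=> mY mZ Yy Zz e e0; have e20 : 0 < e / 2 by rewrite divr_gt0.
apply: cvg_measure0_subU (Yy _ e20) (Zz _ e20) => [n|n|n|].
- by apply: measurable_deviation; exact: measurable_funB.
- exact: measurable_deviation.
- exact: measurable_deviation.
apply: nearW => n w /= ew.
have [|Yn] := ltP (e / 2) `|Y n w - y|; [by left|right].
rewrite ltNge; apply: contraTN ew => Zn.
rewrite -leNgt opprD opprK addrACA -opprB opprB addrC.
rewrite [X in `|X + _|](_ : _ = - (Z n w - z)); last by rewrite opprB addrC.
by rewrite (le_trans (ler_normD _ _))// normrN (splitr e) lerD.
Qed.

Lemma cvg_in_probability_comp Y (u : nat -> nat) (y : R) :
  u @ \oo --> \oo -> cvg_in_probability P Y y ->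
  cvg_in_probability P (fun k => Y (u k)) y.
Proof.
move=> uoo Yy e e0.
exact: (cvg_comp u (fun n => P [set w | e < `|Y n w - y|]) uoo (Yy e e0)).
Qed.

End in_probability.

Lemma near_natrM_ge (R : realType) (r M : R) : 0 < r ->
  \forall n \near \oo, M <= n%:R * r.
Proof.
move=> r0; near=> n; rewrite -ler_pdivrMr//.
by near: n; exact: nbhs_infty_ger.
Unshelve. all: by end_near. Qed.

(** * Order statistics and empirical quantiles of the sample *)

Section empirical_quantile.
Context {d : measure_display} {T : measurableType d} {R : realType}.
Variables (P : probability T R) (X : nat -> {RV P >-> R}) (F : R -> R).
Hypothesis Xindep : independent_RVs X.
Hypothesis XF : forall i x, cdf (X i) x = (F x)%:E.

Let below a i := X i @^-1` `]-oo, a].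

Let mbelow a i : measurable (below a i).
Proof. exact: measurable_funPTI. Qed.

Let Pbelow a i : P (below a i) = (F a)%:E.
Proof. exact: XF. Qed.

Let Pbelow2 a (i j : nat) : i != j ->
  P (below a i `&` below a j) = (F a * F a)%:E.
Proof.
move=> ij.
(* The product rule on a two-element family with the same ray for both indices. *)
have := @Xindep [fset i; j]%fset (fun=> `]-oo, a]%classic).
rewrite big_fsetU1 ?inE//= big_seq_fset1 !Pbelow -EFinM => <-//.
congr (P _); apply/seteqP; split => w /=.
  by move=> [iw jw] k /=; rewrite !inE => /orP[] /eqP ->.
by move=> ijw; split; apply: ijw; rewrite /= !inE eqxx ?orbT.
Qed.

Lemma order_stat_le_occurrences n j a w : (0 < j <= n)%N ->
  (order_stat (fun i => X i w) n j <= a) =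
  (j%:R <= occurrences (below a) n w :> R).
Proof.
move=> jn; rewrite order_stat_leE// /occurrences.
rewrite -(@count_indic _ _ _ _ _ (fun i => X i w <= a)).
  by rewrite ler_nat.
by move=> i; rewrite /below/= in_itv.
Qed.

Lemma measurable_order_stat n j :
  measurable_fun setT (fun w => order_stat (fun i => X i w) n j).
Proof.
(* Ranks 0 and 1 read the same entry, because of [j.-1]. *)
wlog j0 : j / (0 < j)%N => [h|].
  by case: j => [|j]; [exact: (h 1%N)|exact: h].
have [jn|nj] := leqP j n; last first.
  rewrite [X in measurable_fun _ X](_ : _ = cst 0)//.
  apply/funext => w; rewrite /order_stat nth_default//.
  by rewrite size_sort size_map size_iota; case: j j0 nj.
(* Open upper rays generate the Borel sets, and their preimages say that fewer than [j] observations
   are at most [a]. *)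
apply: (measurability _ (RGenOInfty.measurableE R)) => //.
move=> /= _ [_ [a ->] <-]; rewrite setTI.
rewrite (_ : _ @^-1` _ = (occurrences (below a) n : T -> R) @^-1` `]-oo, j%:R[).
  by rewrite -[X in measurable X]setTI; apply: measurable_occurrences.
by apply/seteqP; split => w /=;
  rewrite !in_itv/= andbT !ltNge order_stat_le_occurrences ?j0.
Qed.

Theorem emp_quantile_cvg_in_probability q : 0 < q < 1 ->
  quantile F q = sup [set x | F x <= q] ->
  cvg_in_probability P (fun n w => emp_quantile (fun i => X i w) n q)
    (quantile F q).
Proof.
move=> /andP[q0 q1] Fq e e0; set Q := quantile F q.
have Fa : F (Q - e) < q.
  by apply: (lt_quantile (XF 0%N)) => //; rewrite ltrBlDr ltrDl.
have Fb : q < F (Q + e).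
  by apply: (gt_quantile (XF 0%N)) => //; rewrite ltrDl.
set N := fun a => occurrences (R := R) (below a).
pose D a de n := [set w | n%:R * de <= `|N a n w - n%:R * F a|].
have mD a de n : measurable (D a de n).
  rewrite -[X in measurable X]setTI.
  have mg : measurable_fun setT (fun w => `|N a n w - n%:R * F a|).
    apply: measurableT_comp => //; apply: measurable_funB => //.
    exact: measurable_occurrences.
  rewrite (_ : D a de n =
    (fun w => `|N a n w - n%:R * F a|) @^-1` `[n%:R * de, +oo[).
    exact: mg.
  by apply/seteqP; split => w /=; rewrite in_itv/= andbT.
(* Half of each gap is the frequency error to be detected; the other half, once multiplied by a
   large [n], absorbs the rounding of the rank. *)
pose da := (q - F (Q - e)) / 2; pose db := (F (Q + e) - q) / 2.
have da0 : 0 < da by rewrite divr_gt0// subr_gt0.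
have db0 : 0 < db by rewrite divr_gt0// subr_gt0.
have lima := occurrences_weak_law (mbelow (Q - e)) (Pbelow _) (@Pbelow2 _) da0.
have limb := occurrences_weak_law (mbelow (Q + e)) (Pbelow _) (@Pbelow2 _) db0.
apply: cvg_measure0_subU lima limb => [n|n|n|].
- by apply: measurable_deviation; exact: measurable_order_stat.
- exact: mD.
- exact: mD.
near=> n.
have nq : 1 <= n%:R * q by near: n; exact: near_natrM_ge.
have nda : 1 <= n%:R * da by near: n; exact: near_natrM_ge.
have ndb : 1 <= n%:R * db by near: n; exact: near_natrM_ge.
set j := Num.truncn (n.+1%:R * q).
have nq0 : 0 <= n.+1%:R * q by rewrite mulr_ge0// ltW.
have /andP[j1 j2] := truncn_itv nq0.
rewrite -/j -!natr1 mulrDl mul1r in j1 j2.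
(* The rank is in range: [n q >= 1] gives [j >= 1], and [(n + 1) q < n + 1] gives [j <= n]. *)
have jn : (0 < j <= n)%N.
  rewrite truncn_gt0 truncn_le_nat -natr1 mulrDl mul1r; apply/andP; split.
    by rewrite (le_trans nq)// lerDl ltW.
  have : n%:R * q <= n%:R by rewrite ler_piMr// ltW.
  lra.
move=> w; rewrite /= /emp_quantile -/j => ew.
(* Too many observations up to [Q - e]: their number is at least [j > n q + q - 1], against an
   expected [n F (Q - e)]. *)
have [lea|gta] := leP (order_stat (fun i => X i w) n j) (Q - e).
  left; move: lea; rewrite order_stat_le_occurrences// -/(N _ _ _) => jN.
  rewrite (le_trans _ (ler_norm _))//.
  by move: nda; rewrite /da; lra.
(* Too few observations up to [Q + e]: their number is below [j <= n q + q], against an expected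
   [n F (Q + e)]. *)
right; have : Q + e < order_stat (fun i => X i w) n j.
  by move: ew; case: ger0P; lra.
rewrite ltNge order_stat_le_occurrences// -/(N _ _ _) -ltNge => Nj.
rewrite distrC (le_trans _ (ler_norm _))//.
by move: ndb; rewrite /db; lra.
Unshelve. all: by end_near. Qed.

(** The common shape of both fences, along all sample sizes. *)
Lemma emp_quantile_combination_cvg (p q a b : R) : 0 < p < 1 -> 0 < q < 1 ->
  unique_quantiles F ->
  cvg_in_probability P
    (fun n w => a * emp_quantile (fun i => X i w) n p -
                b * emp_quantile (fun i => X i w) n q)
    (a * quantile F p - b * quantile F q).
Proof.
move=> p01 q01 Fquant; apply: cvg_in_probabilityB => [n|n||].
- by apply: measurable_funM => //; exact: measurable_order_stat.
- by apply: measurable_funM => //; exact: measurable_order_stat.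
- apply: cvg_in_probabilityZ; apply: emp_quantile_cvg_in_probability => //.
  exact: Fquant.
- apply: cvg_in_probabilityZ; apply: emp_quantile_cvg_in_probability => //.
  exact: Fquant.
Qed.

End empirical_quantile.

Theorem theorem4 (R : realType) (d : measure_display) (T : measurableType d)
    (P : probability T R) (X : nat -> {RV P >-> R}) (F : R -> R)
    (Xindep : independent_RVs X)
    (XF : forall (i : nat) (x : R), cdf (X i) x = (F x)%:E)
    (Fac : absolutely_continuous F) (Fquant : unique_quantiles F)
    (s : nat) (s2 : (2 <= s)%N) :
  cvg_in_probability P
    (fun (k : nat) (w : T) =>
      emp_left_fence (fun i => X i w) (s.+1 * k - 1)%N (s.+1%:R^-1))
    (left_fence F (s.+1%:R^-1)) /\
  cvg_in_probability P
    (fun (k : nat) (w : T) =>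
      emp_right_fence (fun i => X i w) (s.+1 * k - 1)%N (s.+1%:R^-1))
    (right_fence F (s.+1%:R^-1)).
Proof.
have p01 : 0 < (s.+1%:R^-1 : R) < 1.
  by rewrite invr_gt0 ltr0n/= invf_lt1 ?ltr0n// ltr1n ltnS ltnW.
(* The subtraction truncates at [k = 0], which does not affect the limit. *)
have noo : (s.+1 * k - 1)%N @[k --> \oo] --> \oo.
  apply/cvgnyPge => M; near=> k.
  have kM : (M.+1 <= k)%N by near: k; exact: nbhs_infty_ge.
  rewrite leq_subRL ?add1n; first by rewrite (leq_trans kM)// leq_pmull.
  by rewrite muln_gt0/= (leq_trans _ kM).
have q01 : 0 < 1 - (s.+1%:R^-1 : R) < 1.
  by rewrite subr_gt0 gtrDl oppr_lt0 andbC.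
split.
(* Unfolding the fence gives the coefficients [1 / p] and [(1 - p) / p] at the levels [p] and
   [1 - p]; the right fence swaps the levels. *)
- exact: (cvg_in_probability_comp noo
    (emp_quantile_combination_cvg Xindep XF _ _ p01 q01 Fquant)).
- exact: (cvg_in_probability_comp noo
    (emp_quantile_combination_cvg Xindep XF _ _ q01 p01 Fquant)).
Unshelve. all: by end_near. Qed.
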